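(* Let $G=(V,E^S\cup E^R)$ be a social-request graph with request capacities $R_{ij}>0$, social capacities $S_{ij}$, and utilities per unit service $U_{ij}\in\mathbb{R}$ ($e^R_{ij}\in E^R$). Then the maximum utility of sensing service provided under STAR, i.e. the maximum of $\sum_{i,j:\,e^R_{ij}\in E^R}U_{ij}f^R_{ij}$ over aggregate flows $f$ of feasible sets of balanced flows along STAR cycles, is equal to the maximum utility of a circulation flow in $G$, i.e. the maximum of $\sum_{i,j:\,e^R_{ij}\in E^R}U_{ij}f^R_{ij}$ over all circulation flows $f$ in $G$.
   Context: $V=\{1,\dots,N\}$ is a finite set of users. The request graph $(V,E^R)$ is directed, has no loops, and has at most one request edge $e^R_{ij}$ from $i$ to $j$; $e^R_{ij}\in E^R$ means that $j$ requests service from $i$, in the amount $R_{ij}>0$, and $U_{ij}$ is the utility to $j$ of each unit of service provided by $i$. The social graph $(V,E^S)$ is directed, has no loops, and has at most one social edge $e^S_{ij}$ from $i$ to $j$, with capacity $S_{ij}$. Convention: social edges come in pairs, i.e. $e^S_{ij}\in E^S$ iff $e^S_{ji}\in E^S$; a missing reverse edge is represented by an edge of capacity $0$, and all other social capacities are positive. The social-request graph $G=(V,E^S\cup E^R)$ is the directed multigraph containing all request and social edges; a social edge and a request edge between the same nodes are distinct edges. Social edges generate no utility. Flows are $D$-valued, where $D=\mathbb{R}$ (divisible service) or $D=\mathbb{Z}$ (indivisible service). A STAR cycle is a (simple) directed cycle in $G$ all of whose edges have positive capacity. A balanced flow along a STAR cycle $c$ has the same value $f_c\ge 0$, $f_c\in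 D$, on each edge of $c$. The aggregate flow of a finite set of balanced flows $\{f_c:c\in\mathcal C\}$ is \[f^S_{ij}=\sum_{c\in\mathcal C:\,e^S_{ij}\in c}f_c-\sum_{c\in\mathcal C:\,e^S_{ji}\in c}f_c,\qquad f^R_{ij}=\sum_{c\in\mathcal C:\,e^R_{ij}\in c}f_c .\] The capacity constraints are: $-S_{ji}\le f^S_{ij}\le S_{ij}$ and $f^S_{ji}=-f^S_{ij}$ for all $e^S_{ij}\in E^S$; and $0\le f^R_{ij}\le R_{ij}$ for all $e^R_{ij}\in E^R$. A set of balanced flows is feasible if its aggregate flow satisfies the capacity constraints. A circulation flow in $G$ is a ($D$-valued) flow $f=(f^S_{ij},f^R_{ij})$ that satisfies the capacity constraints and the conservation constraints \[\sum_{j:\,e^R_{ij}\in E^R}f^R_{ij}+\sum_{j:\,e^S_{ij}\in E^S}f^S_{ij}=\sum_{j:\,e^R_{ji}\in E^R}f^R_{ji}\qquad\text{for all } i\in V .\] *)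

(* Defs.v *)
From mathcomp Require Import all_boot all_order all_algebra.
From mathcomp Require Import classical_sets reals.

Set Implicit Arguments.
Unset Strict Implicit.
Unset Printing Implicit Defensive.

Import Order.TTheory GRing.Theory Num.Theory.
Local Open Scope ring_scope.

(* Values of capacities outside the edge relations are irrelevant: every use
   below is guarded by [req] or [soc]. *)
Record sr_graph (R : realType) (N : nat) := SRGraph {
  req : rel 'I_N; (* [req i j]: user j requests service from user i *)
  soc : rel 'I_N;
  rcap : 'I_N -> 'I_N -> R;
  scap : 'I_N -> 'I_N -> R;
  req_irr : irreflexive req;
  soc_irr : irreflexive soc;
  soc_sym : symmetric soc;
  rcap_gt0 : forall i j, req i j -> 0 < rcap i j;
  scap_ge0 : forall i j, soc i j -> 0 <= scap i j;
  (* capacity 0 only encodes a missing reverse edge, so it never occurs in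
     both directions at once *)
  scap_pair_gt0 : forall i j, soc i j -> 0 < scap i j \/ 0 < scap j i }.

(* The set D of admissible flow values, as a subset of the reals. *)
Inductive service := Divisible | Indivisible.

Definition admissible (R : realType) (D : service) (x : R) : Prop :=
  match D with
  | Divisible => True
  | Indivisible => x \is a Num.int
  end.

(* Edges of the multigraph: parallel social and request edges stay distinct. *)
Definition edge (N : nat) : Type := ('I_N * 'I_N + 'I_N * 'I_N)%type.

Definition social N (i j : 'I_N) : edge N := inl (i, j).
Definition request N (i j : 'I_N) : edge N := inr (i, j).

Definition src N (e : edge N) : 'I_N :=
  match e with inl p => p.1 | inr p => p.1 end.
Definition dst N (e : edge N) : 'I_N :=
  match e with inl p => p.2 | inr p => p.2 end.

Section Flows.
Context (R : realType) (N : nat) (G : sr_graph R N).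

Definition in_graph (e : edge N) : bool :=
  match e with inl p => soc G p.1 p.2 | inr p => req G p.1 p.2 end.

Definition capacity (e : edge N) : R :=
  match e with inl p => scap G p.1 p.2 | inr p => rcap G p.1 p.2 end.

(* A cycle is identified with its set of edges, so that rotations of the same
   edge sequence are one and the same cycle. *)
Definition star_cycle (c : {set edge N}) : Prop :=
  exists s : seq (edge N),
    [/\ s != [::],
        cycle [rel e e' | dst e == src e'] s,
        uniq [seq src e | e <- s],
        (forall e, e \in s -> in_graph e /\ 0 < capacity e)
      & c = [set e in s]].

(* Only the values on edges of the graph are meaningful. *)
Record flow := Flow {
  fS : 'I_N -> 'I_N -> R;
  fR : 'I_N -> 'I_N -> R }.

Definition capacity_constraints (f : flow) : Prop :=
  (forall i j, soc G i j ->
     [/\ - scap G j i <= fS f i j, fS f i j <= scap G i j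
       & fS f j i = - fS f i j]) /\
  (forall i j, req G i j -> 0 <= fR f i j /\ fR f i j <= rcap G i j).

Definition conservation (f : flow) : Prop :=
  forall i, \sum_(j | req G i j) fR f i j + \sum_(j | soc G i j) fS f i j
            = \sum_(j | req G j i) fR f j i.

Definition circulation (D : service) (f : flow) : Prop :=
  [/\ forall i j, soc G i j -> admissible D (fS f i j),
      forall i j, req G i j -> admissible D (fR f i j),
      capacity_constraints f
    & conservation f].

(* [b c] is the common value of the balanced flow on the edges of [c]. *)
Definition aggregate (C : {set {set edge N}}) (b : {set edge N} -> R) : flow :=
  Flow (fun i j => \sum_(c in C | social i j \in c) b c
                   - \sum_(c in C | social j i \in c) b c)
       (fun i j => \sum_(c in C | request i j \in c) b c).

Definition balanced_flows (D : service)
    (C : {set {set edge N}}) (b : {set edge N} -> R) : Prop :=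
  forall c, c \in C -> [/\ star_cycle c, 0 <= b c & admissible D (b c)].

Definition star_flow (D : service) (f : flow) : Prop :=
  exists C b, [/\ balanced_flows D C b, capacity_constraints (aggregate C b)
                & f = aggregate C b].

Definition utility (U : 'I_N -> 'I_N -> R) (f : flow) : R :=
  \sum_i \sum_(j | req G i j) U i j * fR f i j.

End Flows.

Definition is_maximum (R : realType) (A : set R) (m : R) : Prop :=
  A m /\ ubound A m.

(* Main.v *)
(** Splitting each social value into its positive part on one of the two
    opposite edges turns a circulation into a nonnegative conserved edge flow
    that respects the capacities.  Such an edge flow is a sum of balanced flows
    along STAR cycles: a simple cycle exists in its support, and subtracting the
    least value along it shrinks the support.  Conversely, aggregates of
    balanced flows are conserved, so both problems have the same attainable
    utilities.  The bounded edge flows form a compact set, whether real or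
    integral, so a linear utility attains its maximum on it. *)

Require Import Defs.
From mathcomp Require Import all_boot all_order all_algebra.
From mathcomp Require Import classical_sets reals.
From mathcomp Require Import boolp cardinality topology normedtype derive.

Set Implicit Arguments.
Unset Strict Implicit.
Unset Printing Implicit Defensive.

Import Order.TTheory GRing.Theory Num.Theory.
Import numFieldNormedType.Exports.
Local Open Scope classical_set_scope.
Local Open Scope ring_scope.

(** * Compactness of the sets of admissible values *)

Section Admissible.
Variables (R : realType) (D : service).
Implicit Types x y : R.

Lemma admissible0 : admissible D (0 : R).
Proof. by case: D => //=; rewrite rpred0. Qed.

Lemma admissibleD x y :
  admissible D x -> admissible D y -> admissible D (x + y).
Proof. by case: D => //=; exact: rpredD. Qed.

Lemma admissibleB x y :
  admissible D x -> admissible D y -> admissible D (x - y).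
Proof. by case: D => //=; exact: rpredB. Qed.

(** Divisible values fill a segment; indivisible ones are among finitely many naturals. *)
Lemma compact_admissible (b : R) :
  compact [set x | [/\ 0 <= x, x <= b & admissible D x]].
Proof.
case: D => /=.
- have -> : [set x | [/\ 0 <= x, x <= b & True]] = `[0, b]%classic.
    apply/seteqP; split => x /=; rewrite in_itv /=; first by case=> -> ->.
    by move=> /andP[].
  exact: segment_compact.
- apply: finite_compact.
  apply: (@sub_finite_set _ _
    ((fun n => n%:R) @` [set n : nat | (n < (Num.truncn b).+1)%N])).
    move=> x [x0 xb]; rewrite intrEge0// => /natrP[n xE]; exists n => //=.
    by rewrite ltnS truncn_ge_nat -?xE// (le_trans x0 xb).
  by apply: finite_image; exact: finite_II.
Qed.

End Admissible.

(** * Attainment of linear maxima *)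

(** Extreme value theorem on row vectors, where a product of compact sets is compact and each linear
    equation cuts out a closed set. Arbitrary compact sets [K i] cover intervals and finite sets of
    integers alike. *)
Lemma compact_linear_program_max (R : realType) (I J : finType)
    (K : I -> set R) (a : J -> I -> R) (u : I -> R) (x0 : I -> R)
    (P := fun x : I -> R =>
      (forall i, K i (x i)) /\ forall j, \sum_i a j i * x i = 0) :
  (forall i, compact (K i)) -> P x0 ->
  exists2 x, P x &
    forall y, P y -> \sum_i u i * y i <= \sum_i u i * x i.
Proof.
move=> cK Px0.
pose F (w : I -> R) (v : 'rV[R]_#|I|) := \sum_i w i * v ord0 (enum_rank i).
have Fc w : continuous (F w).
  apply: continuous_big => [|i _ v]; first exact: add_continuous.
  by apply: continuousM; [exact: cst_continuous|exact: coord_continuous].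
pose A := [set v : 'rV[R]_#|I| | (forall k, K (enum_val k) (v ord0 k)) /\
   forall j, F (a j) v = 0].
pose ofv (v : 'rV[R]_#|I|) i := v ord0 (enum_rank i).
pose tov (x : I -> R) : 'rV[R]_#|I| := \row_k x (enum_val k).
have ofvK x i : tov x ord0 (enum_rank i) = x i by rewrite mxE enum_rankK.
have Fto w x : F w (tov x) = \sum_i w i * x i.
  by apply: eq_bigr => i _; rewrite ofvK.
have Ato x : P x -> A (tov x).
  by case=> Kx ax; split=> [k|j]; rewrite ?mxE ?Fto.
have cA : compact A.
  have -> : A = [set v : 'rV[R]_#|I| | forall k, K (enum_val k) (v ord0 k)] `&`
     \bigcap_(j in [set: J]) (F (a j) @^-1` [set 0]).
    apply/seteqP; split=> v [Kv av]; split=> // j; [move=> _|]; exact: av.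
  apply: compact_closedI.
    exact: (@rV_compact _ _ (fun k => K (enum_val k))).
  apply: closed_bigI => j _; apply: preimage_closed => [v _|]; first exact: Fc.
  by apply: accessible_closed_set1; exact: hausdorff_accessible.
have A0 : A !=set0 by exists (tov x0); exact: Ato.
have [v /set_mem[Kv av] vmax] :=
  compact_EVT_max A0 cA (continuous_subspaceT (Fc u)).
exists (ofv v).
  by split=> // i; have := Kv (enum_rank i); rewrite enum_rankK.
by move=> y Py; rewrite -Fto; apply/vmax/mem_set/Ato.
Qed.

(** * Simple cycles and cycle decomposition *)

Definition simple_cycle N (s : seq (edge N)) :=
  [/\ s != [::], cycle [rel e e' | dst e == src e'] s
    & uniq [seq src e | e <- s]].

Definition conserved (R : nmodType) N (g : edge N -> R) :=
  forall v, \sum_(e | src e == v) g e = \sum_(e | dst e == v) g e.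

(* Leaving each vertex by a chosen edge of [P] defines a self-map of a finite
   set, whose iterates from any starting vertex are eventually periodic. *)
Lemma exists_simple_cycle N (P : pred (edge N)) (e0 : edge N) :
  P e0 -> (forall e, P e -> exists2 e', P e' & src e' = dst e) ->
  exists2 s, simple_cycle s & all P s.
Proof.
move=> Pe0 Pnext.
(* The default is taken only at vertices that no edge of [P] leaves; the trajectory of [src e0]
   never meets one. *)
pose o v := odflt e0 [pick e | P e && (src e == v)].
have oP v : (exists2 e, P e & src e = v) -> P (o v) /\ src (o v) = v.
  case=> e Pe ev; rewrite /o; case: pickP => [e' /andP[? /eqP]|/(_ e)] //=.
  by rewrite Pe ev eqxx.
pose f v := dst (o v).
pose x := src e0.
have outx k : exists2 e, P e & src e = iter k f x.
  elim: k => [|k /oP[Po _]]; first by exists e0.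
  by rewrite iterS; apply: Pnext.
(* After [order f x] steps the trajectory is back at an earlier iterate, so the orbit of that
   iterate closes up into a cycle. *)
have /trajectP[i lti xE] := looping_order f x.
pose y := iter i f x.
have yP : iter (order f x - i) f y = y by rewrite -iterD subnK// ltnW.
have cy : fcycle f (orbit f y).
  apply/(orbitPcycle 0 3); exists (order f x - i).-1.
  by rewrite prednK// subn_gt0.
have outy v : v \in orbit f y -> P (o v) /\ src (o v) = v.
  move=> /trajectP[k _ ->]; apply: oP.
  by rewrite /y -iterD; apply: outx.
have srcE : [seq src e | e <- map o (orbit f y)] = orbit f y.
  by rewrite -map_comp -[RHS]map_id; apply/eq_in_map => v /outy[].
exists (map o (orbit f y)).
- split.
  + by rewrite -size_eq0 size_map size_orbit -lt0n order_gt0.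
  + rewrite cycle_map; apply: (sub_in_cycle _ (allss _) cy) => a b.
    by move=> /outy[_ _] /outy[_ sb]; rewrite /= sb.
  + by rewrite srcE orbit_uniq.
- by rewrite all_map; apply/allP => v /outy[].
Qed.

(** Each edge ends where the next one starts, so the destinations are the sources rotated by one
    place. *)
Lemma simple_cycle_dst N (s : seq (edge N)) :
  simple_cycle s -> perm_eq [seq dst e | e <- s] [seq src e | e <- s].
Proof.
case: s => [[]//|e s [_ /= + _]]; rewrite -map_cons.
have H (a b : edge N) t : path [rel e e' | dst e == src e'] a (rcons t b) ->
    [seq dst i | i <- a :: t] = rcons [seq src i | i <- t] (src b).
  by elim: t a => [|c t IH] a /= => [/andP[/eqP->]//|/andP[/eqP-> /IH <-]].
by move=> /H ->; rewrite perm_sym /= -cats1 -[_ :: _]cat1s perm_catC.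
Qed.

(** A vertex occurs equally often among the sources and the destinations. *)
Lemma simple_cycle_conserved (R : nmodType) N (s : seq (edge N)) (m : R) :
  simple_cycle s -> conserved (fun e => if e \in s then m else 0).
Proof.
move=> cs v; have us : uniq s by have [_ _ /map_uniq] := cs.
have sumE (h : edge N -> 'I_N) : \sum_(e | h e == v) (if e \in s then m else 0)
    = \sum_(w <- map h s | w == v) m.
  rewrite big_map [RHS]big_mkcond big_uniq//= -!big_mkcondr.
  by apply: eq_bigl => e; rewrite andbC.
by rewrite !sumE; apply: perm_big; rewrite perm_sym simple_cycle_dst.
Qed.

Lemma conservedB (R : zmodType) N (g h : edge N -> R) :
  conserved g -> conserved h -> conserved (fun e => g e - h e).
Proof. by move=> cg ch v; rewrite !sumrB cg ch. Qed.

(** Induction on the number of edges with positive value. The cycles are recorded to stay inside the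
    support of [g], so that a capacity bound on [g] later makes them STAR cycles. *)
Lemma cycle_decomposition (R : realType) (D : service) N (g : edge N -> R) :
  (forall e, 0 <= g e) -> (forall e, admissible D (g e)) -> conserved g ->
  exists b : {set edge N} -> R,
    [/\ forall c, 0 <= b c,
        forall c, admissible D (b c),
        forall c, b c != 0 -> exists2 s, simple_cycle s &
          c = [set e in s]%SET /\ forall e, e \in s -> 0 < g e
      & forall e, g e = \sum_(c : {set edge N} | e \in c) b c].
Proof.
have [n] := ubnP #|[pred e | 0 < g e]|; elim: n g => // n IH g.
rewrite ltnS => gn g0 gD gc.
have [e0 Pe0|supp0] := pickP [pred e | 0 < g e]; last first.
  exists (fun=> 0); split=> //; first by move=> _; exact: admissible0.
    by move=> c; rewrite eqxx.
  move=> e; rewrite big1//; apply/eqP; rewrite eq_le g0 andbT leNgt.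
  by have /= -> := supp0 e.
(* A positive edge gives its end positive inflow, hence by conservation positive outflow. *)
have nextP e : 0 < g e -> exists2 e', 0 < g e' & src e' = dst e.
  move=> ge.
  have : 0 < \sum_(e' | src e' == dst e) g e'.
    by rewrite gc (bigD1 e)//= ltr_pwDl// sumr_ge0.
  rewrite lt_def => /andP[/eqP sum_neq0 _].
  have [e' /andP[/eqP se ge']|none] :=
    pickP [pred e' | (src e' == dst e) && (0 < g e')]; first by exists e'.
  case: sum_neq0; apply: big1 => e' se'; apply/eqP.
  by rewrite eq_le g0 andbT leNgt; have /= := none e'; rewrite se' /= => ->.
have [s cs /allP Ps] := @exists_simple_cycle _ (fun e => 0 < g e) e0 Pe0 nextP.
have [e1 e1s] : exists e, e \in s.
  by case: cs; case: (s) => // e *; exists e; rewrite mem_head.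
(* Subtracting the least value [g e2] along the cycle preserves nonnegativity and removes [e2] from
   the support; being a value of [g], it is admissible. *)
have [e2 e2s e2min] : exists2 e2, e2 \in s & forall e, e \in s -> g e2 <= g e.
  by have [e2] := @arg_minP _ _ _ e1 (mem s) g e1s; exists e2.
pose m := g e2; pose g' e := g e - (if e \in s then m else 0).
have m0 : 0 < m by exact: Ps.
have g'g e : g' e <= g e by rewrite gerBl; case: ifP => // _; exact: ltW.
have [|e|e||b [b0 bD bs bE]] := IH g'.
- apply: leq_trans gn; apply/proper_card/properP; split.
    by apply/fintype.subsetP => e; rewrite !inE => /lt_le_trans; apply.
  exists e2; first by rewrite inE.
  by rewrite inE /g' e2s subrr ltxx.
- by rewrite subr_ge0; case: ifP => // /e2min.
- apply: admissibleB => //; case: ifP => _; [exact: gD|exact: admissible0].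
- by apply: conservedB => //; exact: simple_cycle_conserved.
exists (fun c => b c + (if c == [set e in s]%SET then m else 0)); split.
- by move=> c; rewrite addr_ge0//; case: ifP => // _; exact: ltW.
- move=> c; apply: admissibleD => //.
  by case: ifP => _; [exact: gD|exact: admissible0].
- move=> c; case: (c =P [set e in s]%SET) => [-> _|_].
    by exists s => //; split=> // e /Ps.
  rewrite addr0 => /bs[t ct [-> tg']]; exists t => //; split=> // e /tg' ge.
  exact: lt_le_trans (g'g e).
- move=> e; rewrite big_split/= -bE /g' -big_mkcondr/=.
  have [es|es] := boolP (e \in s).
    rewrite (big_pred1 [set e in s]%SET) ?subrK// => c /=.
    by rewrite andbC; case: eqP => // ->; rewrite inE es.
  rewrite subr0 big1 ?addr0// => c /andP[ec /eqP cE].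
  by move: ec es; rewrite cE inE => ->.
Qed.

(** * Circulations as conserved edge flows *)

Section StarCirculation.
Variables (R : realType) (N : nat) (G : sr_graph R N).
Implicit Types (D : service) (g : edge N -> R) (f : flow R N) (e : edge N).

Definition flow_of_edges g : flow R N :=
  Flow (fun i j => g (social i j) - g (social j i))
       (fun i j => g (request i j)).

(** The bound 0 off the graph lets sums run over all possible edges. Opposite social edges may both
    carry flow. *)
Definition edge_circulation D g :=
  (forall e, [/\ 0 <= g e, g e <= (if in_graph G e then capacity G e else 0)
               & admissible D (g e)]) /\ conserved g.

Lemma sum_src g v :
  \sum_(e | src e == v) g e =
  \sum_j g (social v j) + \sum_j g (request v j).
Proof.
have H (h : 'I_N * 'I_N -> R) : \sum_(p | p.1 == v) h p = \sum_j h (v, j).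
  rewrite (reindex_onto (fun j => (v, j)) snd) => [|[i j] /eqP <-]//=.
  by apply: eq_bigl => j; rewrite !eqxx.
by rewrite big_sumType/= !H.
Qed.

Lemma sum_dst g v :
  \sum_(e | dst e == v) g e =
  \sum_j g (social j v) + \sum_j g (request j v).
Proof.
have H (h : 'I_N * 'I_N -> R) : \sum_(p | p.2 == v) h p = \sum_j h (j, v).
  rewrite (reindex_onto (fun j => (j, v)) fst) => [|[i j] /eqP <-]//=.
  by apply: eq_bigl => j; rewrite !eqxx.
by rewrite big_sumType/= !H.
Qed.

(** Net social outflow counts incoming social flow with a minus sign, and [soc] is symmetric; both
    laws thus say that the same difference of outflow and inflow vanishes. *)
Lemma conservation_flow_of_edges g :
  (forall e, ~~ in_graph G e -> g e = 0) ->
  conservation G (flow_of_edges g) <-> conserved g.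
Proof.
move=> g0.
have gE (h : 'I_N -> edge N) :
    \sum_(j | in_graph G (h j)) g (h j) = \sum_j g (h j).
  by rewrite big_mkcond; apply: eq_bigr => j _; case: ifPn => // /g0.
have E v : \sum_(j | req G v j) fR (flow_of_edges g) v j
      + \sum_(j | soc G v j) fS (flow_of_edges g) v j
      - \sum_(j | req G j v) fR (flow_of_edges g) j v
    = \sum_(e | src e == v) g e - \sum_(e | dst e == v) g e.
  rewrite /= sumrB sum_src sum_dst.
  rewrite (gE (fun j => request v j)) (gE (fun j => request j v)).
  have -> : \sum_(j | soc G v j) g (social j v) = \sum_j g (social j v).
    by rewrite -gE; apply: eq_bigl => j; rewrite /= soc_sym.
  rewrite (gE (fun j => social v j)).
  by rewrite addrA opprD addrA [\sum_j g (request v j) + _]addrC.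
by split=> gc v; apply/eqP; rewrite -subr_eq0; [rewrite -E gc|rewrite E gc];
   rewrite subrr.
Qed.

(** The flow comes from the edge flow that sums the cycles through each edge; exchanging sums
    reduces conservation to a single cycle. *)
Lemma star_flow_circulation D f : star_flow G D f -> circulation G D f.
Proof.
move=> [C [b [bC capf fE]]]; have bD c : c \in C -> admissible D (b c).
  by case/bC.
pose g e := \sum_(c in C | e \in c) b c.
have gD e : admissible D (g e).
  rewrite /g; elim/big_ind: _ => [|x y|c /andP[/bD]]//.
    exact: admissible0.
  exact: admissibleD.
rewrite fE; split => //=.
- by move=> i j _; apply: admissibleB; exact: gD.
- by move=> i j _; exact: gD.
apply/(@conservation_flow_of_edges g).
  move=> e eG; rewrite /g big1// => c /andP[/bC[[s [_ _ _ sG ->]] _ _]].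
  by rewrite inE => /sG[]; rewrite (negPf eG).
have gE e : g e = \sum_(c in C) (if e \in c then b c else 0).
  exact: big_mkcondr.
move=> v; rewrite !(eq_bigr _ (fun e _ => gE e)).
rewrite exchange_big [RHS]exchange_big/=.
apply: eq_bigr => c /bC[[s [s0 sc su _ ->]] _ _].
have cs : simple_cycle s by [].
have mE e : (if e \in [set e in s]%SET then b [set e in s]%SET else 0)
    = (if e \in s then b [set e in s]%SET else 0) by rewrite inE.
rewrite !(eq_bigr _ (fun e _ => mE e)).
exact: simple_cycle_conserved.
Qed.

(** Only utilities are compared: off the graph [f] is arbitrary, so it may differ from
    [flow_of_edges g]. *)
Lemma circulation_edge_circulation D f : circulation G D f ->
  exists2 g, edge_circulation D g &
    forall U, utility G U (flow_of_edges g) = utility G U f.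
Proof.
case=> fSD fRD [capS capR] cf.
(* By antisymmetry of [fS f] on social edges, at most one of two opposite edges gets a nonzero
   value. *)
pose g e := match e with
  | inl (i, j) => if soc G i j then Num.max 0 (fS f i j) else 0
  | inr (i, j) => if req G i j then fR f i j else 0
  end.
have gS i j : soc G i j -> g (social i j) - g (social j i) = fS f i j.
  move=> sij; have [_ _ fN] := capS _ _ sij; rewrite /= sij soc_sym sij fN.
  have [f0|f0] := lerP 0 (fS f i j).
    by rewrite max_l ?oppr_le0// subr0.
  by rewrite max_r ?oppr_ge0 1?ltW// sub0r opprK.
exists g; last first.
  move=> U; apply: eq_bigr => i _; apply: eq_bigr => j rij /=.
  by rewrite rij.
split; last first.
  apply/conservation_flow_of_edges => [[[i j]|[i j]]/= /negPf->//|v].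
  rewrite /=; under eq_bigr => j -> do [].
  under [\sum_(j | soc G v j) _]eq_bigr => j sj do rewrite (gS _ _ sj).
  by rewrite [RHS](eq_bigr (fun j => fR f j v)) => [|j ->].
move=> [[i j]|[i j]] /=; case: ifP => ij.
- have [_ fle _] := capS _ _ ij; split.
  + by rewrite le_max lexx.
  + by rewrite ge_max fle scap_ge0.
  + by rewrite maxEle; case: ifP => _; [exact: fSD|exact: admissible0].
- by split=> //; exact: admissible0.
- by have [? ?] := capR _ _ ij; split=> //; exact: fRD.
- by split=> //; exact: admissible0.
Qed.

Lemma edge_circulation_star_flow D g : edge_circulation D g ->
  star_flow G D (flow_of_edges g).
Proof.
move=> [gP gc].
have g0 e : 0 <= g e by have [] := gP e.
have gD e : admissible D (g e) by have [] := gP e.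
have [b [b0 bD bs bE]] := cycle_decomposition g0 gD gc.
(* Sets of nonzero weight are known to be simple cycles; dropping the others changes no sum. *)
exists [set c | b c != 0]%SET, b.
have gE e : \sum_(c in [set c | b c != 0]%SET | e \in c) b c = g e.
  rewrite bE big_mkcondl/=; apply: eq_bigr => c _.
  by rewrite inE; case: eqP.
have flowE : flow_of_edges g = aggregate [set c | b c != 0]%SET b.
  by rewrite -(funext gE).
split=> //.
  move=> c; rewrite inE => /bs[s [s0 sc su] [cE sg]]; split=> //.
  exists s; split=> // e /sg ge.
  (* A positive value forces the edge into the graph, since the bound is 0 elsewhere, and makes its
     capacity positive. *)
  have [_ + _] := gP e; case: ifP => _ /(lt_le_trans ge) //.
  by rewrite ltxx.
rewrite -flowE; split=> i j ij /=.
  (* Both edge values are nonnegative, so their difference lies between minus the one capacity and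
     the other. *)
  have [gij0 + _] := gP (social i j); have [gji0 + _] := gP (social j i).
  rewrite /= soc_sym ij => le_ji le_ij; split; last by rewrite opprB.
    by rewrite lerBrDr (le_trans _ gij0)// addrC subr_le0.
  by rewrite lerBlDr (le_trans le_ij)// lerDl.
by have [? + _] := gP (request i j); rewrite /= ij.
Qed.

(** A linear program over compact coordinate sets, feasible because of the zero flow. *)
Lemma edge_circulation_max D (U : 'I_N -> 'I_N -> R) :
  exists2 g, edge_circulation D g & forall h, edge_circulation D h ->
    utility G U (flow_of_edges h) <= utility G U (flow_of_edges g).
Proof.
pose u e := if e is inr (i, j) then if req G i j then U i j else 0 else 0.
have uE g : utility G U (flow_of_edges g) = \sum_e u e * g e.
  rewrite big_sumType/= big1 ?add0r => [|[i j] _]; last by rewrite mul0r.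
  rewrite /utility pair_big_dep/= big_mkcond; apply: eq_bigr => -[i j] _ /=.
  by case: ifP; rewrite ?mul0r.
(* The signed incidence matrix turns conservation into a homogeneous linear system. *)
pose a v e : R := (src e == v)%:R - (dst e == v)%:R.
have aE g v :
    \sum_e a v e * g e =
    \sum_(e | src e == v) g e - \sum_(e | dst e == v) g e.
  rewrite [in RHS]big_mkcond [X in _ - X]big_mkcond -sumrB.
  by apply: eq_bigr => e _; rewrite mulrBl !mulr_natl !mulrb.
pose K e := [set x : R | [/\ 0 <= x,
   x <= (if in_graph G e then capacity G e else 0) & admissible D x]].
have KP g : edge_circulation D g <->
   (forall e, K e (g e)) /\ forall v, \sum_e a v e * g e = 0.
  split=> -[gK gc]; split=> // v; first by rewrite aE gc subrr.
  by apply/eqP; rewrite -subr_eq0 -aE gc.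
have K0 : edge_circulation D (fun=> 0).
  split=> [e|v]; last by rewrite !big1.
  split=> //; last exact: admissible0.
  case: ifP => //; case: e => [[i j]|[i j]] /= ij; first exact: scap_ge0.
  exact/ltW/rcap_gt0.
have cK e : compact (K e) by exact: compact_admissible.
have [g /KP gP gmax] := compact_linear_program_max u cK (iffLR (KP _) K0).
by exists g => // h /KP /gmax; rewrite !uE.
Qed.

End StarCirculation.

Theorem theorem2 (R : realType) (N : nat) (G : sr_graph R N)
    (U : 'I_N -> 'I_N -> R) (D : service) :
  exists m : R,
    is_maximum [set utility G U f | f in [set f | star_flow G D f]] m /\
    is_maximum [set utility G U f | f in [set f | circulation G D f]] m.
Proof.
have [g gP gmax] := edge_circulation_max G D U.
have gstar := edge_circulation_star_flow gP.
(* One bound serves both problems: every STAR flow is a circulation, and the maximizer is itself a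
   STAR flow. *)
have fmax f : circulation G D f ->
    utility G U f <= utility G U (flow_of_edges g).
  by case/circulation_edge_circulation => h /gmax + <-.
exists (utility G U (flow_of_edges g)); split; split.
- by exists (flow_of_edges g).
- by move=> _ [f /star_flow_circulation/fmax + <-].
- by exists (flow_of_edges g) => //; exact: star_flow_circulation.
- by move=> _ [f /fmax + <-].
Qed.
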